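(* Let $\mathcal X$ be a discrete instance space with a weighted improvement graph $G=(\mathcal X,E)$ with cost function $\mathrm{cost}:E\to\mathbb R^+$ (nonnegative reals), a self-loop at every node and $\mathrm{cost}(x,x)=0$ for every $x$. Let $\mathcal Y=\{z_1,\dots,z_k\}$ be a finite label set with value function $\mathrm{val}:\mathcal Y\to\mathbb R$ satisfying $\mathrm{val}(z_i)<\mathrm{val}(z_j)$ for all $i<j$, and assume $\mathrm{val}(z_k)-\mathrm{val}(z_1)>\mathrm{cost}(x,v)$ for every $x\in\mathcal X$ and $v\in\Delta(x)$. Let $\mathcal H\subseteq\mathcal Y^{\mathcal X}$. The optimal mistake bound of deterministic learners in the full feedback multiclass online learning with improvement setting with this weighted graph, for sequences realizable by $\mathcal H$, equals $\mathrm{WILdim}(\mathcal H)$.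
   Context: Improvement sets: $\Delta(x)=\{v:(x,v)\in E\}$, with $x\in\Delta(x)$. Best response: given $h:\mathcal X\to\mathcal Y$ and $x$, the agent moves to a $v\in\Delta(x)$ maximizing $\mathrm{val}(h(v))-\mathrm{val}(h(x))-\mathrm{cost}(x,v)$ (ties broken adversarially); if there is no $v\in\Delta(x)$ with $\mathrm{val}(h(v))-\mathrm{val}(h(x))-\mathrm{cost}(x,v)>0$, the agent does not move. Game: at each round $t=1,2,\dots$: the environment presents an agent $x^{(t)}$; the learner implements a hypothesis $h^{(t)}:\mathcal X\to\mathcal Y$; the agent best responds to $h^{(t)}$ and ends at $v^{(t)}\in\Delta(x^{(t)})$; the environment selects $y^{(t)}\in\mathcal Y$; the learner makes a mistake iff $h^{(t)}(v^{(t)})\neq y^{(t)}$. Full feedback: upon making a mistake the learner receives the agent's final features $v^{(t)}$ and the true label $y^{(t)}$. The sequence is realizable by $\mathcal H$ if there is $h^*\in\mathcal H$ with $h^*(v^{(t)})=y^{(t)}$ for all $t$. The optimal mistake bound is the smallest worst-case number of mistakes, over realizable sequences, achieved by a deterministic learner. For $x\in\mathcal X$ and $v\in\Delta(x)$ let $Y_{x,v}=\{y\in\mathcal Y:\mathrm{val}(y)-\mathrm{val}(z_1)<\mathrm{cost}(x,v)\}$. Weighted improvement Littlestone tree (WILT): a tree whose nodes are labeled by elements of $\mathcal X$, in which each internal node $x$ has the following set of outgoing edges: two edges labeled $(x,y_1)$ and $(x,y_2)$ with $y_1\neq y_2$; and for each $v\in\Delta(x)\setminus\{x\}$, either a single edge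 labeled $(v,y)$ with $y\in Y_{x,v}$, or two edges labeled $(v,y_3),(v,y_4)$ for some $y_3\ne y_4$ with $y_3,y_4\in\mathcal Y\setminus Y_{x,v}$. A WILT is shattered by $\mathcal H$ if each root-to-leaf branch is realizable by $\mathcal H$, i.e. for every branch with edge labels $(u_1,y_1),\dots,(u_d,y_d)$ there is $h\in\mathcal H$ with $h(u_i)=y_i$ for all $i$. The depth of a tree is the length of its shortest branch. $\mathrm{WILdim}(\mathcal H)$ is the maximum depth of a WILT shattered by $\mathcal H$.
   Formalization: The printed claim fails if val(y)−val(z_1)=cost(x,v), as moving needs strict gain. Proved with ≤ for < in Y_{x,v}, and with the printed Y_{x,v} if val(y)−val(z_1)≠cost(x,v) for all x, v≠x in Δ(x), y. If the gain has no maximum on Δ(x), the agent stays. *)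

(* Defs.v *)
From HB Require Import structures.
From mathcomp Require Import all_boot all_order all_algebra.
From mathcomp Require Import boolp classical_sets reals ereal.

Set Implicit Arguments.
Unset Strict Implicit.
Unset Printing Implicit Defensive.

Import Order.TTheory GRing.Theory Num.Theory.
Local Open Scope ring_scope.

(* The label set {z_1 < ... < z_k} is 'I_n.+1 with k = n + 1, so that z_1 is
   ord0 and z_k is ord_max. *)

(* Supremum in {0, 1, 2, ...} U {+oo}; in particular the supremum of the empty
   set is 0, whereas that of ereal_sup is -oo. *)
Definition nat_sup (R : realType) (A : set nat) : \bar R :=
  ereal_sup (0%E |` [set (m%:R)%:E | m in A])%classic.

Section Setting.
Variables (R : realType) (X : Type) (n : nat).
Notation Y := 'I_n.+1.
Variables (E : X -> X -> Prop) (cost : X -> X -> R) (value : Y -> R).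

Definition Delta (x : X) : set X := [set v | E x v]%classic.

Definition gain (h : X -> Y) (x v : X) : R :=
  value (h v) - value (h x) - cost x v.

Definition maximizer (h : X -> Y) (x v : X) : Prop :=
  Delta x v /\ forall w, Delta x w -> gain h x w <= gain h x v.

(* A relation, because ties are broken adversarially.  If the gain attains its
   maximum over Delta x (for instance if Delta x is finite), the second
   disjunct says that v = x and that no move has positive gain.  If Delta x is
   infinite and the maximum is not attained, there is no best move and the
   agent stays at x. *)
Definition best_response (h : X -> Y) (x v : X) : Prop :=
  (maximizer h x v /\ 0 < gain h x v) \/
  (v = x /\ ~ exists w, maximizer h x w /\ 0 < gain h x w).

(* A deterministic learner maps the past rounds and the current agent to a
   hypothesis.  A past round is recorded as its agent together with the
   feedback: None if the learner was correct, and the final features and the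
   true label otherwise. *)
Definition learner : Type := seq (X * option (X * Y)) -> X -> (X -> Y).

Section Play.
Variables (L : learner) (x v : nat -> X) (y : nat -> Y).

Fixpoint history (t : nat) : seq (X * option (X * Y)) :=
  if t is s.+1 then
    let hs := L (history s) (x s) in
    rcons (history s)
      (x s, if hs (v s) == y s then None else Some (v s, y s))
  else [::].

Definition hypothesis (t : nat) : X -> Y := L (history t) (x t).

Definition play : Prop := forall t, best_response (hypothesis t) (x t) (v t).

Definition mistakes (T : nat) : nat :=
  (\sum_(t < T) (hypothesis t (v t) != y t))%N.

End Play.

Definition realizable (H : set (X -> Y)) (v : nat -> X) (y : nat -> Y) : Prop :=
  exists2 h, H h & forall t, h (v t) = y t.

(* The number of mistakes in an infinite play is the supremum over T of the
   number of mistakes in its first T rounds. *)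
Definition worst_case_mistakes (H : set (X -> Y)) (L : learner) : \bar R :=
  nat_sup R [set m | exists x v y T,
    [/\ play L x v y, realizable H v y & m = mistakes L x v y T]]%classic.

Definition optimal_mistake_bound (H : set (X -> Y)) : \bar R :=
  ereal_inf [set worst_case_mistakes H L | L in [set: learner]]%classic.

(* The outgoing edges of Node x lab sub are the pairs (u, y) with y \in lab u,
   and sub u y is the subtree below that edge; the other values of sub are
   irrelevant.  Branching may be infinite, but all branches are finite.  This
   loses nothing for the supremum of the depths: a tree with infinite branches
   can be truncated at any finite level. *)
Inductive tree : Type :=
| Leaf of X
| Node of X & (X -> {set Y}) & (X -> Y -> tree).

Inductive branch : tree -> seq (X * Y) -> Prop :=
| branch_leaf x : branch (Leaf x) [::]
| branch_node x (lab : X -> {set Y}) (sub : X -> Y -> tree) u y b :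
    y \in lab u -> branch (sub u y) b ->
    branch (Node x lab sub) ((u, y) :: b).

(* The label sets Y_{x,v} are a parameter S of the trees. *)
Fixpoint wilt (S : X -> X -> {set Y}) (t : tree) : Prop :=
  match t with
  | Leaf _ => True
  | Node x lab sub =>
    [/\ exists y1 y2, y1 != y2 /\ lab x = [set y1; y2]%SET,
        forall v, Delta x v -> v <> x ->
          (exists2 y, y \in S x v & lab v = [set y]%SET) \/
          (exists y3 y4, [/\ y3 != y4, y3 \notin S x v, y4 \notin S x v
                           & lab v = [set y3; y4]%SET]),
        forall v, ~ Delta x v -> lab v = finset.set0
      & forall u y, y \in lab u -> wilt S (sub u y)]
  end.

Definition shattered (H : set (X -> Y)) (t : tree) : Prop :=
  forall b, branch t b ->
    exists2 h, H h & all (fun e => h e.1 == e.2) b.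

Definition has_depth (t : tree) (d : nat) : Prop :=
  (exists2 b, branch t b & size b = d) /\
  forall b, branch t b -> (d <= size b)%N.

Definition WILdim (S : X -> X -> {set Y}) (H : set (X -> Y)) : \bar R :=
  nat_sup R [set d | exists t,
    [/\ wilt S t, shattered H t & has_depth t d]]%classic.

Definition Ylt (x v : X) : {set Y} :=
  [set y | value y - value ord0 < cost x v]%SET.

(* The labels that cannot attract an agent from x to v.  An agent moves only
   for a strictly positive gain, so a label whose value exceeds that of z_1 by
   exactly cost x v belongs to this set, although it does not belong to Ylt. *)
Definition Yle (x v : X) : {set Y} :=
  [set y | value y - value ord0 <= cost x v]%SET.

End Setting.

(* Main.v *)
(* Call a class V of hypotheses of rank at least m if V is nonempty and m = 0,
   or if some agent x carries labels admissible for a tree node such that every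
   restriction of V along an edge has rank at least m - 1.  The dimension is
   the largest rank of H.  Descending along the edges, the adversary forces a
   mistake per unit of rank: an agent who leaves x for v gains strictly, so the
   label the learner gave to v is outside Yle x v, and some edge at v carries
   another label.  Conversely, if V does not have rank m + 1, then at the given
   x the node cannot be built: there is a vertex v, either x itself or a
   neighbour that can be made attractive, at which at most one label y,
   outside Yle x v in the second case, leaves a class of rank m.  The learner
   puts y at v and the lowest label everywhere else, so that the agent ends at
   v and every mistake lowers the rank. *)
Require Import Defs.
From HB Require Import structures.
From mathcomp Require Import all_boot all_order all_algebra.
From mathcomp Require Import boolp classical_sets reals ereal.
Import Order.TTheory GRing.Theory Num.Theory.
Local Open Scope ring_scope.

Set Implicit Arguments.
Unset Strict Implicit.
Unset Printing Implicit Defensive.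

(** * Suprema of sets of naturals in the extended reals *)

Section NatSup.
Variable R : realType.
Implicit Type A : set nat.
Local Open Scope ereal_scope.

Lemma nat_sup_ge0 A : 0 <= nat_sup R A.
Proof. by apply: ereal_sup_ubound; left. Qed.

Lemma nat_sup_ge A m : A m -> (m%:R)%:E <= nat_sup R A.
Proof. by move=> Am; apply: ereal_sup_ubound; right; exists m. Qed.

Lemma nat_sup_le A (z : \bar R) :
  0 <= z -> (forall m, A m -> (m%:R)%:E <= z) -> nat_sup R A <= z.
Proof. by move=> z0 Az; apply: ge_ereal_sup => _ [->//|[m Am <-]]; exact: Az. Qed.

Lemma nat_sup_unbounded A :
  (forall m, exists2 d, A d & (m <= d)%N) -> nat_sup R A = +oo.
Proof.
move=> unbA; apply/eqP; rewrite -leye_eq leNgt; apply/negP => supA_lt.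
have : nat_sup R A \is a fin_num.
  by rewrite ge0_fin_numE // nat_sup_ge0.
move=> /fineK supE.
have [d Ad] := unbA (Num.bound (fine (nat_sup R A))).
move=> bound_le.
have := nat_sup_ge Ad; rewrite -supE lee_fin; apply/negP; rewrite -ltNge.
have sup_ge0 : (0 <= fine (nat_sup R A))%R by rewrite fine_ge0 // nat_sup_ge0.
by apply: (lt_le_trans (archi_boundP sup_ge0)); rewrite ler_nat.
Qed.

End NatSup.

(** * Ranks of classes and depths of shattered trees *)

Section Rank.
Variables (X : Type) (n : nat).
Notation Y := 'I_n.+1.
Variables (E : X -> X -> Prop) (S : X -> X -> {set Y}).
Implicit Types (V : set (X -> Y)) (t : tree X n).

Definition restrict V u y : set (X -> Y) := [set h | V h /\ h u = y]%classic.

Definition admissible (x : X) (lab : X -> {set Y}) : Prop :=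
  [/\ exists y1 y2, y1 != y2 /\ lab x = [set y1; y2]%SET,
      forall v, Delta E x v -> v <> x ->
        (exists2 y, y \in S x v & lab v = [set y]%SET) \/
        (exists y3 y4, [/\ y3 != y4, y3 \notin S x v, y4 \notin S x v
                         & lab v = [set y3; y4]%SET])
    & forall v, ~ Delta E x v -> lab v = finset.set0].

(** Only the condition at a single node is kept from [wilt], so a failure of rank [m.+1] can be
    exploited at one agent. Rank 0 asks for a member because the empty branch of a leaf must still
    be realized by some hypothesis. *)
Fixpoint rank_ge V (m : nat) : Prop :=
  if m is k.+1 then
    exists x lab, admissible x lab /\
      forall u y, y \in lab u -> rank_ge (restrict V u y) k
  else exists h, V h.

(** The edges at the agent itself always exist, and following them reaches a leaf. *)
Lemma wilt_branch t : wilt E S t -> exists b, branch t b.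
Proof.
elim: t => [x _|x lab sub IH]; first by exists [::]; constructor.
case=> -[y1 [y2 [_ labx]]] _ _ wsub.
have y1x : y1 \in lab x by rewrite labx !inE eqxx.
have [b bb] := IH _ _ (wsub _ _ y1x).
by exists ((x, y1) :: b); constructor.
Qed.

(** Induction on [m] rather than on the tree ignores all levels below depth [m]. *)
Lemma wilt_rank_ge m V t : wilt E S t -> shattered V t ->
  (forall b, branch t b -> (m <= size b)%N) -> rank_ge V m.
Proof.
elim: m V t => [|m IH] V t wt sht dt.
  by have [b bb] := wilt_branch wt; have [h Vh _] := sht b bb; exists h.
case: t wt sht dt => [x _ _ dt|x lab sub]; first by have := dt _ (branch_leaf n x).
case=> lab1 lab2 lab3 wsub sht dt; exists x, lab; split=> // u y ylab.
apply: (IH _ (sub u y)); first exact: wsub.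
- move=> b bb; have [h Vh /= /andP[/eqP huy hb]] := sht _ (branch_node x ylab bb).
  by exists h.
- by move=> b bb; exact: (dt _ (branch_node x ylab bb)).
Qed.

Lemma rank_ge_wilt (x0 : X) m V : rank_ge V m ->
  exists t, [/\ wilt E S t, shattered V t
              & forall b, branch t b -> (m <= size b)%N].
Proof.
elim: m V => [|m IH] V.
  by move=> [h Vh]; exists (Leaf n x0); split=> // b bb; exists h => //; inversion bb.
move=> [x [lab [[lab1 lab2 lab3] rk]]].
(* Choice picks the subtrees of all edges at once; a leaf fills the pairs that are not edges. *)
have /choice[sub subP] : forall e : X * Y, exists t, e.2 \in lab e.1 ->
    [/\ wilt E S t, shattered (restrict V e.1 e.2) t
      & forall b, branch t b -> (m <= size b)%N].
  move=> [u y] /=; case: (boolP (y \in lab u)) => [/rk/IH[t tP]|_].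
    by exists t.
  by exists (Leaf n x0).
exists (Node x lab (fun u y => sub (u, y))); split.
- by split=> // u y /(subP (u, y))[].
- move=> b bb; inversion bb as [|? ? ? u y b' ylab bb'].
  have [_ sh _] := subP (u, y) ylab.
  have [h [Vh huy] hb] := sh _ bb'.
  by exists h => //=; rewrite huy eqxx.
- move=> b bb; inversion bb as [|? ? ? u y b' ylab bb'].
  by have [_ _ d] := subP (u, y) ylab; apply: (d b').
Qed.

Lemma has_depth_ge t m : wilt E S t ->
  (forall b, branch t b -> (m <= size b)%N) ->
  exists2 d, has_depth t d & (m <= d)%N.
Proof.
move=> /wilt_branch[b0 bb0] mt.
have ex : exists d, `[< exists2 b, branch t b & size b = d >].
  by exists (size b0); apply/asboolP; exists b0.
have [d /asboolP[b bb bd] dmin] := ex_minnP ex.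
exists d; last by rewrite -bd; exact: mt.
split; first by exists b.
by move=> b' bb'; apply: dmin; apply/asboolP; exists b'.
Qed.

(** A positive rank supplies an agent to label the leaves. At rank 0 the type [X] may be empty, and
    then there is no tree. *)
Lemma rank_geS_depth V m : rank_ge V m.+1 ->
  exists2 d, (exists t, [/\ wilt E S t, shattered V t & has_depth t d])
           & (m < d)%N.
Proof.
move=> rk; have [x _] := rk.
have [t [wt sht mt]] := rank_ge_wilt x rk.
by have [d td md] := has_depth_ge wt mt; exists d => //; exists t.
Qed.

End Rank.

Lemma wilt_congr (X : Type) (n : nat) (E : X -> X -> Prop)
    (S S' : X -> X -> {set 'I_n.+1}) (t : tree X n) :
  (forall x v, Delta E x v -> v <> x -> S x v = S' x v) ->
  wilt E S t -> wilt E S' t.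
Proof.
move=> SS'; elim: t => [//|x lab sub IH] [lab1 lab2 lab3 wsub].
split=> // [v xv vx|u y ylab]; last by apply: IH; exact: wsub.
by rewrite -SS' //; exact: lab2.
Qed.

Section Game.
Variables (R : realType) (X : Type) (n : nat).
Notation Y := 'I_n.+1.
Variables (E : X -> X -> Prop) (cost : X -> X -> R) (value : Y -> R).
Hypothesis E_refl : forall x, E x x.
Hypothesis cost_ge0 : forall x v, E x v -> 0 <= cost x v.
Hypothesis value_mono : forall i j : Y, (i < j)%N -> value i < value j.
Hypothesis value_gt_cost : forall x v, Delta E x v ->
  cost x v < value ord_max - value ord0.
Implicit Types (V H : set (X -> Y)) (L : learner X n).

Notation best_response := (best_response E cost value).
Notation play := (play E cost value).
Notation rank_ge := (rank_ge E (Yle cost value)).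

(** * Best responses *)

Lemma value_ord0_le y : value ord0 <= value y.
Proof.
case: (posnP y) => [y0|/(@value_mono ord0 y)/ltW//].
by have -> : y = ord0 by exact: val_inj.
Qed.

Lemma best_response_ex (h : X -> Y) x : exists v, best_response h x v.
Proof.
have [[w wP]|noex] :=
    pselect (exists w, maximizer E cost value h x w /\ 0 < gain cost value h x w).
  by exists w; left.
by exists x; right.
Qed.

Lemma best_response_Delta (h : X -> Y) x v : best_response h x v -> Delta E x v.
Proof. by move=> [[[]]//|[-> _]]; exact: E_refl. Qed.

(** The move beats its cost relative to the label at [x], hence also relative to the lowest
    label. *)
Lemma best_response_notin_Yle (h : X -> Y) x v :
  best_response h x v -> v <> x -> h v \notin Yle cost value x v.
Proof.
move=> [[_ gain_gt0] _|[-> _]//]; rewrite inE -ltNge.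
rewrite /gain subr_gt0 in gain_gt0.
by apply: (lt_le_trans gain_gt0); rewrite lerB // value_ord0_le.
Qed.

(** * Hypotheses that steer the agent to one vertex *)

Definition spike (v : X) (y : Y) (w : X) : Y := if `[< w = v >] then y else ord0.

Lemma spikeE v y : spike v y v = y.
Proof. by rewrite /spike; case: asboolP. Qed.

Lemma spike_neq v y w : w <> v -> spike v y w = ord0.
Proof. by rewrite /spike; case: asboolP. Qed.

Lemma gain_spike_le0 v y x w : Delta E x w -> w <> v ->
  gain cost value (spike v y) x w <= 0.
Proof.
move=> xw wv; rewrite /gain (spike_neq _ wv).
by rewrite subr_le0 (@le_trans _ _ 0) ?cost_ge0 // subr_le0 value_ord0_le.
Qed.

Lemma best_response_spike_self x y v : best_response (spike x y) x v -> v = x.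
Proof.
move=> [[[xv _] gain_gt0]|[]//]; apply: contrapT => vx.
by move: gain_gt0; rewrite ltNge gain_spike_le0.
Qed.

(** Only [u] has positive gain, so the maximum is attained even on an infinite neighbourhood, and
    staying at [x] is excluded. *)
Lemma best_response_spike x u y v : Delta E x u -> u <> x ->
  y \notin Yle cost value x u -> best_response (spike u y) x v -> v = u.
Proof.
move=> xu ux; rewrite inE -ltNge => cost_lt br; apply: contrapT => vu.
have gain_u : 0 < gain cost value (spike u y) x u.
  by rewrite /gain spikeE spike_neq ?subr_gt0 // => xu'; apply: ux.
case: br => [[[xv _]]|[_ []]]; first by rewrite ltNge gain_spike_le0.
exists u; split=> //; split=> // w xw.
have [->//|wu] := pselect (w = u).
by rewrite (le_trans (gain_spike_le0 _ xw wu)) // ltW.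
Qed.

(** By contraposition: if every hypothesis fails then every [spike] fails, and the labels witnessing
    these failures form a node that gives rank [m.+1]. *)
Lemma learner_step V m x : ~ rank_ge V m.+1 ->
  exists h, forall v y, best_response h x v -> y != h v ->
    ~ rank_ge (restrict V v y) m.
Proof.
move=> Nrk; apply: contrapT => Nh; apply: Nrk.
(* A failing spike yields a label of rank [m] other than its own; using that label for a second
   spike yields two distinct ones. *)
have other v y : (forall w, best_response (spike v y) x w -> w = v) ->
    exists2 y', y' != y & rank_ge (restrict V v y') m.
  move=> brv; apply: contrapT => Ny'; apply: Nh; exists (spike v y) => w y'.
  by move=> /brv ->; rewrite spikeE => y'y rk; apply: Ny'; exists y'.
have /choice[lab labP] : forall v, exists l : {set Y},
    [/\ v = x -> exists y1 y2, y1 != y2 /\ l = [set y1; y2]%SET,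
        Delta E x v -> v <> x ->
          (exists2 y, y \in Yle cost value x v & l = [set y]%SET) \/
          (exists y3 y4, [/\ y3 != y4, y3 \notin Yle cost value x v,
             y4 \notin Yle cost value x v & l = [set y3; y4]%SET]),
        ~ Delta E x v -> l = finset.set0
      & forall y, y \in l -> rank_ge (restrict V v y) m].
  move=> v.
  have [->|vx] := pselect (v = x).
    have [y1 _ rk1] := other x ord0 (@best_response_spike_self x _).
    have [y2 y21 rk2] := other x y1 (@best_response_spike_self x _).
    exists [set y2; y1]%SET; split=> // [_|/(_ (E_refl x))//|y].
      by exists y2, y1.
    by rewrite !inE => /orP[]/eqP->.
  have [xv|Nxv] := pselect (Delta E x v); last first.
    by exists finset.set0; split=> // y; rewrite inE.
  (* One label in [Yle] of rank [m] is enough for a single edge. Otherwise every label of rank [m]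
     is outside [Yle] and so can attract the agent to [v]. *)
  have [[y yle rk]|Nyle] := pselect (exists2 y, y \in Yle cost value x v &
      rank_ge (restrict V v y) m).
    exists [set y]%SET; split=> // [_ _|y']; first by left; exists y.
    by rewrite !inE => /eqP->.
  have Nle y : rank_ge (restrict V v y) m -> y \notin Yle cost value x v.
    by move=> rk; apply/negP => yle; apply: Nyle; exists y.
  (* The first spike at [v] needs a label sure to attract the agent; the bound on costs provides the
     top one. *)
  have max_Nle : ord_max \notin Yle cost value x v.
    by rewrite inE -ltNge value_gt_cost.
  have [y3 _ rk3] := other v _ (fun w => best_response_spike xv vx max_Nle).
  have [y4 y43 rk4] := other v _ (fun w => best_response_spike xv vx (Nle _ rk3)).
  exists [set y4; y3]%SET; split=> // [_ _|y].
    by right; exists y4, y3; split=> //; exact: Nle.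
  by rewrite !inE => /orP[]/eqP->.
exists x, lab; split; last by move=> u y; have [_ _ _] := labP u; apply.
split=> [|v|v]; first by have [+ _ _ _] := labP x; apply.
  by have [_ + _ _] := labP v; apply.
by have [_ _ + _] := labP v; apply.
Qed.

(** * The learner *)

Definition version_space H (hs : seq (X * option (X * Y))) : set (X -> Y) :=
  foldl (fun V r => if r.2 is Some e then restrict V e.1 e.2 else V) H hs.

(** Computed from the recorded feedback, so that the learner can use it to select a hypothesis. *)
Definition nb_mistakes (hs : seq (X * option (X * Y))) : nat :=
  count (fun r => isSome r.2) hs.

Lemma mistakesS L x v y T : mistakes L x v y T.+1 =
  (mistakes L x v y T + (hypothesis L x v y T (v T) != y T))%N.
Proof. by rewrite /mistakes big_ord_recr. Qed.

Lemma nb_mistakes_history L x v y T :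
  nb_mistakes (history L x v y T) = mistakes L x v y T.
Proof.
elim: T => [|T IH]; first by rewrite /mistakes big_ord0.
rewrite mistakesS -IH /nb_mistakes /= -cats1 count_cat /= addn0 /hypothesis.
by case: eqP.
Qed.

Lemma realizable_version_space H L x v y h T :
  H h -> (forall t, h (v t) = y t) -> version_space H (history L x v y T) h.
Proof.
move=> Hh hvy; elim: T => [//|T IH]; rewrite /version_space /= foldl_rcons /=.
by case: ifP => _ //=; split.
Qed.

Lemma learner_ex H D : ~ rank_ge H D.+1 ->
  exists L, forall x v y T, play L x v y -> realizable H v y ->
    (mistakes L x v y T <= D)%N.
Proof.
move=> NrkH.
(* Here [m] is the remaining budget of mistakes; the equation with [D] avoids truncated
   subtraction. *)
have /choice[L' L'P] : forall p : seq (X * option (X * Y)) * X, exists h,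
    forall m, (nb_mistakes p.1 + m)%N = D ->
    ~ rank_ge (version_space H p.1) m.+1 ->
    forall v y, best_response h p.2 v -> y != h v ->
      ~ rank_ge (restrict (version_space H p.1) v y) m.
  move=> [hs x] /=.
  have [Nrk|rk] := pselect (~ rank_ge (version_space H hs) (D - nb_mistakes hs).+1).
    have [h hP] := learner_step x Nrk; exists h => m mD.
    by move: hP; rewrite -mD addKn.
  (* A default for histories whose version space has too large a rank; the invariant below shows
     that realizable play never meets them. *)
  exists (fun=> ord0) => m mD Nrk; exfalso; apply: rk.
  by rewrite -mD addKn.
exists (fun hs x => L' (hs, x)) => x v y T playL [h Hh hvy].
set L := fun hs x => _ in playL *.
(* Invariant: with [m] mistakes left, the version space lacks rank [m.+1]. *)
suff [m [mD _]] : exists m, (mistakes L x v y T + m)%N = D /\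
    ~ rank_ge (version_space H (history L x v y T)) m.+1.
  by rewrite -mD leq_addr.
elim: T => [|T [m [mD Nrk]]].
  by exists D; rewrite /mistakes big_ord0.
have step := L'P (history L x v y T, x T) m; rewrite /= nb_mistakes_history in step.
have {}step := step mD Nrk (v T) (y T) (playL T).
have hV := realizable_version_space L x T.+1 Hh hvy.
rewrite mistakesS /version_space /= foldl_rcons /= -/(hypothesis L x v y T) in hV *.
case: eqP => [_|/eqP hy] in hV *; first by exists m; rewrite addn0.
rewrite eq_sym in hy; have {}step := step hy.
(* A mistake with no budget left would empty the version space, which still contains [h]. *)
case: m mD Nrk step => [|m] mD Nrk step; first by case: step; exists h.
by exists m; rewrite addn1 addSnnS.
Qed.

(** * The adversary *)

Definition scons (T : Type) (a : T) (s : nat -> T) (t : nat) : T :=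
  if t is t'.+1 then s t' else a.

(** After the first round, the game restarts against the learner that has [r] prepended to its
    memory; this drives the induction on the rank. *)
Lemma history_scons L x v y x0 v0 y0 t :
  let r := (x0, if L [::] x0 v0 == y0 then None else Some (v0, y0)) in
  history L (scons x0 x) (scons v0 v) (scons y0 y) t.+1 =
  r :: history (fun hs => L (r :: hs)) x v y t.
Proof.
move=> r; elim: t => [//|t IH].
by rewrite [LHS]/= -/(history _ _ _ _ t.+1) IH.
Qed.

(** Plays are infinite, so after the forced mistakes the adversary must continue consistently with
    some [h]. *)
Lemma play_agreeing L (x0 : X) (h : X -> Y) :
  exists x v y, play L x v y /\ forall t, h (v t) = y t.
Proof.
have /choice[br brP] := fun g => best_response_ex g x0.
(* Moves and histories depend on each other; iterating on histories alone breaks the circle. *)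
pose next hs := let g := L hs x0 in
  rcons hs (x0, if g (br g) == h (br g) then None else Some (br g, h (br g))).
pose v t := br (L (iter t next [::]) x0).
exists (fun=> x0), v, (fun t => h (v t)); split=> // t.
have histE s : history L (fun=> x0) v (fun t => h (v t)) s = iter s next [::].
  by elim: s => [//|s IH]; rewrite /= IH.
by rewrite /hypothesis histE; exact: brP.
Qed.

(** One mistake is forced in each of the first [m] rounds. The learner and the class are
    generalized, since both change after a round. *)
Lemma adversary_ex (x0 : X) m L V : rank_ge V m ->
  exists x v y, [/\ play L x v y, realizable V v y & mistakes L x v y m = m].
Proof.
elim: m L V => [|m IH] L V.
  move=> [h Vh]; have [x [v [y [playL hvy]]]] := play_agreeing L x0 h.
  by exists x, v, y; split; rewrite /mistakes ?big_ord0 //; exists h.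
move=> [x1 [lab [[lab1 lab2 _] rk]]].
have [v1 br1] := best_response_ex (L [::] x1) x1.
set g := L [::] x1 in br1.
have two (y y' : Y) : y != y' -> lab v1 = [set y; y']%SET ->
    exists2 y1, y1 \in lab v1 & g v1 != y1.
  move=> yy' ->; have [gy|] := eqVneq (g v1) y.
    by exists y'; rewrite ?inE ?eqxx ?orbT // gy.
  by exists y; rewrite // !inE eqxx.
have [y1 y1lab gy1] : exists2 y1, y1 \in lab v1 & g v1 != y1.
  have [v1x|v1x] := pselect (v1 = x1).
    by rewrite -v1x in lab1; have [y [y' [yy' /(two _ _ yy')]]] := lab1.
  have [[y yle labv]|[y [y' [yy' _ _ /(two _ _ yy')//]]]] :=
    lab2 v1 (best_response_Delta br1) v1x.
  exists y; first by rewrite labv inE.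
  (* The single label lies in [Yle], but the label that drew the agent to [v1] does not, so they
     differ. *)
  by apply: contraNneq (best_response_notin_Yle br1 v1x) => ->.
pose r := (x1, Some (v1, y1)).
have [x [v [y [playL [h [Vh hv1] hvy] misE]]]] :=
  IH (fun hs => L (r :: hs)) _ (rk _ _ y1lab).
exists (scons x1 x), (scons v1 v), (scons y1 y).
have hypS t : hypothesis L (scons x1 x) (scons v1 v) (scons y1 y) t.+1 =
    hypothesis (fun hs => L (r :: hs)) x v y t.
  by rewrite /hypothesis history_scons -/g (negPf gy1).
split.
- by move=> [//|t]; rewrite hypS; exact: playL.
- by exists h => // -[|t] /=.
- rewrite /mistakes big_ord_recl {1}/hypothesis /= -/g gy1 -[in RHS]misE.
  by congr (_ + _)%N; apply: eq_bigr => i _; rewrite hypS.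
Qed.

(** * The two inequalities *)

Local Open Scope ereal_scope.

Lemma WILdim_le_optimal H :
  WILdim R E (Yle cost value) H <= optimal_mistake_bound E cost value H.
Proof.
apply: le_ereal_inf_tmp => _ [L _ <-]; apply: nat_sup_le; first exact: nat_sup_ge0.
move=> d [t [wt sht [_ dt]]]; have rk := wilt_rank_ge wt sht dt.
have x0 : X by case: t {wt sht dt} => [x|x _ _]; exact: x.
have [x [v [y [playL real misE]]]] := adversary_ex x0 L rk.
by apply: nat_sup_ge; exists x, v, y, d.
Qed.

Lemma optimal_le_WILdim H :
  optimal_mistake_bound E cost value H <= WILdim R E (Yle cost value) H.
Proof.
have [rk|Nrk] := pselect (forall m, rank_ge H m.+1).
  rewrite [WILdim _ _ _ _]nat_sup_unbounded ?leey // => m.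
  by have [d dP /ltnW] := rank_geS_depth (rk m); exists d.
have ex : exists D, `[< ~ rank_ge H D.+1 >].
  by have /existsNP[D ND] := Nrk; exists D; apply/asboolP.
have [D /asboolP NrkD minD] := ex_minnP ex.
have D_le : (D%:R)%:E <= WILdim R E (Yle cost value) H.
  (* For [D] equal to 0 there may be no tree at all, but [nat_sup] is still nonnegative. *)
  case: D minD {NrkD} => [|D] minD; first exact: nat_sup_ge0.
  have rkD : rank_ge H D.+1.
    by apply: contrapT => /asboolP/minD; rewrite ltnn.
  have [d dP Dd] := rank_geS_depth rkD.
  by apply: le_trans (nat_sup_ge R dP); rewrite lee_fin ler_nat.
have [L LP] := learner_ex NrkD.
apply: le_trans D_le; apply: (@le_trans _ _ (worst_case_mistakes E cost value H L)).
  by apply: ereal_inf_lbound; exists L.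
apply: nat_sup_le => [|m [x [v [y [T [playL real ->]]]]]]; rewrite lee_fin ?ler0n //.
by rewrite ler_nat; exact: LP.
Qed.

End Game.

(** The sets [Yle] and [Ylt] differ only where a value gap equals a cost, a move of zero gain at
    best. Without such ties at proper neighbours, both define the same trees, whence the second
    conjunct. *)
Theorem theorem4 (R : realType) (X : Type) (n : nat)
  (E : X -> X -> Prop) (cost : X -> X -> R) (value : 'I_n.+1 -> R)
  (H : set (X -> 'I_n.+1))
  (E_refl : forall x, E x x)
  (cost_ge0 : forall x v, E x v -> 0 <= cost x v)
  (cost_refl : forall x, cost x x = 0)
  (value_mono : forall i j : 'I_n.+1, (i < j)%N -> value i < value j)
  (value_gt_cost : forall x v, Delta E x v ->
     cost x v < value ord_max - value ord0) :
  optimal_mistake_bound E cost value H = WILdim R E (Yle cost value) H /\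
  ((forall x v y, Delta E x v -> v <> x ->
      value y - value ord0 <> cost x v) ->
   optimal_mistake_bound E cost value H = WILdim R E (Ylt cost value) H).
Proof.
have optE : optimal_mistake_bound E cost value H = WILdim R E (Yle cost value) H.
  by apply/eqP; rewrite eq_le optimal_le_WILdim // WILdim_le_optimal.
split=> // no_tie; rewrite optE.
have YleE x v : Delta E x v -> v <> x -> Yle cost value x v = Ylt cost value x v.
  move=> xv vx; apply/setP => y; rewrite !inE le_eqVlt.
  by case: eqP => // /no_tie; case.
congr nat_sup; apply/seteqP; split=> d [t [wt sht dt]]; exists t; split=> //.
  exact: wilt_congr wt.
by apply: wilt_congr wt => x v xv vx; rewrite YleE.
Qed.
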